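(* (i) If $\mathfrak q'\subset\mathfrak q$ are (finite-dimensional complex) Lie algebras and $\boldsymbol b(\mathfrak q')=\boldsymbol b(\mathfrak q)$, then $\mathcal S(\mathfrak q)^{\mathfrak q}\subset\mathcal S(\mathfrak q')$. (ii) In particular, if $\mathfrak a\subset\mathfrak q$ is a commutative polarisation, then $\mathcal S(\mathfrak q)^{\mathfrak q}\subset\mathcal S(\mathfrak a)$. (iii) Moreover, if $\mathfrak a_1,\dots,\mathfrak a_k$ are different commutative polarisations in $\mathfrak q$, then $\mathcal S(\mathfrak q)^{\mathfrak q}\subset\mathcal S\bigl(\bigcap_{i=1}^k\mathfrak a_i\bigr)$.
   Context: For a finite-dimensional complex Lie algebra $\mathfrak q$, $\mathcal S(\mathfrak q)$ is its symmetric algebra and $\mathcal S(\mathfrak q)^{\mathfrak q}$ the subalgebra of invariants of the adjoint action (equivalently, the Poisson centre of $\mathcal S(\mathfrak q)$). $\operatorname{ind}\mathfrak q=\min_{\xi\in\mathfrak q^*}\dim\mathfrak q^\xi$, where $\mathfrak q^\xi$ is the stabiliser of $\xi$ in the coadjoint representation, and $\boldsymbol b(\mathfrak q)=(\dim\mathfrak q+\operatorname{ind}\mathfrak q)/2$. A commutative polarisation in $\mathfrak q$ is an abelian subalgebra $\mathfrak a\subset\mathfrak q$ with $\dim\mathfrak a=\boldsymbol b(\mathfrak q)$. For a subspace $\mathfrak a\subset\mathfrak q$, $\mathcal S(\mathfrak a)$ is regarded as a subalgebra of $\mathcal S(\mathfrak q)$. *)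

(* Defs.v *)
From HB Require Import structures.
From mathcomp Require Import all_boot all_order all_algebra.
From mathcomp Require Import boolp classical_sets reals complex.
From mathcomp Require Import mpoly.

Set Implicit Arguments.
Unset Strict Implicit.
Unset Printing Implicit Defensive.

Import Order.TTheory GRing.Theory Num.Theory.
Local Open Scope ring_scope.

HB.mixin Record Vector_isLie (K : fieldType) V & Vector K V := {
  lieb : V -> V -> V;
  lieb_linear_l : forall y, linear (lieb^~ y);
  lieb_linear_r : forall x, linear (lieb x);
  liebxx : forall x, lieb x x = 0;
  lieb_jacobi : forall x y z,
    lieb x (lieb y z) + lieb y (lieb z x) + lieb z (lieb x y) = 0
}.

#[short(type="lieType")]
HB.structure Definition LieAlgebra (K : fieldType) :=
  {V of Vector_isLie K V & Vector K V}.

Arguments lieb {K s} _ _.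
Notation "[ 'lie' x , y ]" := (lieb x y)
  (at level 0, format "[ 'lie'  x ,  y ]") : ring_scope.

Section Subalgebras.
Variables (K : fieldType) (q : lieType K).

Definition lie_closed (U : {vspace q}) : Prop :=
  forall x y, x \in U -> y \in U -> [lie x, y] \in U.

Record lieSubalg := LieSubalg {
  lie_space :> {vspace q};
  lie_spaceP : lie_closed lie_space
}.

Section SubLie.
Variable U : lieSubalg.

Definition sub_lieb (x y : subvs_of U) : subvs_of U :=
  vsproj U [lie vsval x, vsval y].

Lemma sub_liebE x y : vsval (sub_lieb x y) = [lie vsval x, vsval y].
Proof. by rewrite vsprojK // lie_spaceP ?subvsP. Qed.

Lemma sub_lieb_linear_l y : linear (sub_lieb^~ y).
Proof.
move=> a x z; apply: val_inj.
rewrite -![val _]/(vsval _) linearP /= !sub_liebE linearP.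
exact: lieb_linear_l.
Qed.

Lemma sub_lieb_linear_r x : linear (sub_lieb x).
Proof.
move=> a y z; apply: val_inj.
by rewrite -![val _]/(vsval _) linearP /= !sub_liebE linearP lieb_linear_r.
Qed.

Lemma sub_liebxx x : sub_lieb x x = 0.
Proof. by apply: val_inj; rewrite -[val _]/(vsval _) sub_liebE liebxx. Qed.

Lemma sub_lieb_jacobi x y z :
  sub_lieb x (sub_lieb y z) + sub_lieb y (sub_lieb z x)
  + sub_lieb z (sub_lieb x y) = 0.
Proof.
apply: val_inj; rewrite -[val _]/(vsval _) !linearD /= !sub_liebE.
exact: lieb_jacobi.
Qed.

HB.instance Definition _ := Vector_isLie.Build K (subvs_of U)
  sub_lieb_linear_l sub_lieb_linear_r sub_liebxx sub_lieb_jacobi.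

End SubLie.
End Subalgebras.

Section Index.
Variables (K : fieldType) (q : lieType K).

(* linfun is only meaningful on linear functions; coadjE and mem_stab show that
   both uses below are. *)
Definition coadj (x : q) (xi : 'Hom(q, K^o)) : 'Hom(q, K^o) :=
  linfun (fun y : q => - xi [lie x, y]).

Definition stab (xi : 'Hom(q, K^o)) : {vspace q} :=
  lker (linfun (coadj^~ xi)).

Lemma coadjE x xi y : coadj x xi y = - xi [lie x, y].
Proof.
have lin : linear (fun y : q => - xi [lie x, y] : K^o).
  by move=> a u v; rewrite lieb_linear_r linearP opprD scalerN.
pose h := GRing.isLinear.Build _ _ _ _ _ lin.
pose f : {linear q -> K^o} := HB.pack (fun y : q => - xi [lie x, y] : K^o) h.
by rewrite /coadj -[LHS]/(linfun f y) lfunE.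
Qed.

Lemma mem_stab xi x : (x \in stab xi) = (coadj x xi == 0).
Proof.
have lin : linear (coadj^~ xi).
  move=> a u v; apply/lfunP => y; rewrite add_lfunE scale_lfunE !coadjE.
  by rewrite lieb_linear_l linearP opprD scalerN.
pose h := GRing.isLinear.Build _ _ _ _ _ lin.
pose f : {linear q -> 'Hom(q, K^o)} := HB.pack (coadj^~ xi) h.
by rewrite memv_ker -[linfun _]/(linfun f) lfunE.
Qed.

Lemma stab_dim_exists : exists n, `[< exists xi, \dim (stab xi) = n >].
Proof. by exists (\dim (stab 0)); apply/asboolP; exists 0. Qed.

Definition ind : nat := ex_minn stab_dim_exists.

(* rat avoids truncating the division by 2. *)
Definition bnum : rat := (\dim {:q} + ind)%:R / 2.

Lemma ind_min : (exists xi, \dim (stab xi) = ind) /\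
  (forall xi, (ind <= \dim (stab xi))%N).
Proof.
rewrite /ind; case: ex_minnP => m /asboolP exm minm; split=> // xi.
by apply: minm; apply/asboolP; exists xi.
Qed.

Definition lie_abelian (U : {vspace q}) : Prop :=
  forall x y, x \in U -> y \in U -> [lie x, y] = 0.

Definition comm_polarisation (U : {vspace q}) : Prop :=
  [/\ lie_closed U, lie_abelian U & (\dim U)%:R = bnum].

End Index.

Arguments ind {K} q.
Arguments bnum {K} q.

Section SymmetricAlgebra.
Variable K : fieldType.

(* The symmetric algebra, as polynomials in the vectors of vbasis {:V}: 'X_i
   stands for the i-th one. *)
Definition Sym (V : vectType K) := {mpoly K[\dim {:V}]}.

Definition sym_inj (V : vectType K) (v : V) : Sym V :=
  \sum_(i < \dim {:V}) coord (vbasis {:V}) i v *: 'X_i.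

(* The algebra morphism S(V) -> S(W) induced by a linear f : V -> W. *)
Definition sym_map (V W : vectType K) (f : V -> W) (p : Sym V) : Sym W :=
  p \mPo [tuple sym_inj (f (vbasis {:V})`_i) | i < \dim {:V}].

(* S(U) inside S(V): the image of the map induced by the inclusion of U. *)
Definition sym_sub (V : vectType K) (U : {vspace V}) : set (Sym V) :=
  range (sym_map (vsval : subvs_of U -> V)).

(* The derivation of S(q) extending ad x; see sym_ad_inj and sym_adM. *)
Definition sym_ad (q : lieType K) (x : q) (p : Sym q) : Sym q :=
  \sum_(i < \dim {:q}) sym_inj [lie x, (vbasis {:q})`_i] * p^`M(i).

Definition sym_invariants (q : lieType K) : set (Sym q) :=
  [set p | forall x : q, sym_ad x p = 0].

Lemma sym_inj_linear (V : vectType K) : linear (@sym_inj V).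
Proof.
move=> a u v; rewrite /sym_inj scaler_sumr -big_split /=.
by apply: eq_bigr => i _; rewrite linearP /= scalerDl scalerA.
Qed.

HB.instance Definition _ (V : vectType K) :=
  GRing.isLinear.Build K V (Sym V) _ _ (@sym_inj_linear V).

Lemma sym_inj_basis (V : vectType K) (i : 'I_(\dim {:V})) :
  sym_inj (vbasis {:V})`_i = 'X_i.
Proof.
rewrite /sym_inj (bigD1 i) //= coord_free ?(basis_free (vbasisP _)) // eqxx.
rewrite scale1r big1 ?addr0 // => j ji.
rewrite coord_free ?(basis_free (vbasisP _)) //.
by rewrite -[_ == _]/(i == j) eq_sym (negbTE ji) scale0r.
Qed.

Lemma sym_map_inj (V W : vectType K) (f : {linear V -> W}) v :
  sym_map f (sym_inj v) = sym_inj (f v).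
Proof.
rewrite /sym_map {1}/sym_inj linear_sum /=.
rewrite [in RHS](coord_vbasis (memvf v)) !linear_sum /=.
apply: eq_bigr => i _; rewrite linearZ /= comp_mpolyXU !linearZ /=.
by rewrite nth_mktuple.
Qed.

Lemma sym_ad_inj (q : lieType K) (x y : q) :
  sym_ad x (sym_inj y) = sym_inj [lie x, y].
Proof.
have lin : linear (lieb x) by exact: lieb_linear_r.
pose h := GRing.isLinear.Build _ _ _ _ _ lin.
pose f : {linear q -> q} := HB.pack (lieb x) h.
have -> : sym_inj [lie x, y] = \sum_i coord (vbasis {:q}) i y *:
    sym_inj [lie x, (vbasis {:q})`_i].
  rewrite -[[lie x, y]]/(f y) {1}(coord_vbasis (memvf y)) !linear_sum.
  by apply: eq_bigr => i _; rewrite linearZ /= linearZ.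
apply: eq_bigr => i _; rewrite [sym_inj y]/sym_inj raddf_sum /= (bigD1 i) //=.
rewrite big1 ?addr0 => [|j ji]; rewrite mderivZ mderivX mnm1E.
  by rewrite eqxx scale1r -[X in (X - _)%MM]addm0 addmC addmK mpolyX0 -scalerAr mulr1.
by rewrite (negbTE ji) scale0r scaler0.
Qed.

Lemma sym_adD (q : lieType K) (x : q) : {morph sym_ad x : p r / p + r}.
Proof.
move=> p r; rewrite /sym_ad -big_split /=.
by apply: eq_bigr => i _; rewrite mderivD mulrDr.
Qed.

Lemma sym_adM (q : lieType K) (x : q) p r :
  sym_ad x (p * r) = sym_ad x p * r + p * sym_ad x r.
Proof.
rewrite /sym_ad mulr_suml mulr_sumr -big_split /=.
apply: eq_bigr => i _; rewrite mderivM mulrDr.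
by congr (_ + _); [exact: mulrA | exact: mulrCA].
Qed.

End SymmetricAlgebra.
Arguments sym_invariants {K} q.

(* Main.v *)
Require Import Defs.
From HB Require Import structures.
From mathcomp Require Import all_boot all_order all_algebra.
From mathcomp Require Import boolp classical_sets reals complex.
From mathcomp Require Import mpoly.

Import GRing.Theory Num.Theory passmx.
Local Open Scope ring_scope.
Local Open Scope classical_set_scope.

(** View F in S(q) as a polynomial function on the dual q*, with differential
    d_xi F in q at each xi. Invariance of F says that xi [lie y, d_xi F] = 0 for
    all y, that is, d_xi F lies in the stabiliser of xi ([differential_stab]).

    This stabiliser is the radical of the skew form xi [lie x, y]. Call xi
    regular when its dimension is ind q. In all three cases the stabiliser of a
    regular xi lies in the subspace U considered. Indeed, for any U,
      dim U + dim U^perp = dim q + dim (U :&: stab xi),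
    so if dim U + dim (U :&: U^perp) reaches dim q + ind q, then stab xi must be
    inside U ([stab_sub_of_orthogonal]). For a subalgebra q', U :&: U^perp is the
    stabiliser in q' of the restriction of xi, of dimension at least ind q', so
    equality of the numbers b is enough; for a commutative polarisation a,
    a is inside a^perp and 2 dim a = dim q + ind q. Intersections of such U are
    then immediate.

    It remains to pass from stab xi <= U for regular xi to F in S(U)
    ([invariants_sub_of_stab]). Regular points contain the non-vanishing locus
    of a nonzero polynomial D ([exists_regular_poly]). If zeta in q* kills U, the
    derivative of F along zeta is xi |-> zeta (d_xi F), which vanishes at the
    regular points; its product with D vanishes everywhere, hence it is zero
    ([conormal_derivative_eq0]). So F is invariant under translations by the
    annihilator of U, which in characteristic 0 means that F is its own image
    under the projection S(q) -> S(U) ([sym_sub_of_conormal]). *)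

(** * Polynomial functions along lines *)

Section Lines.
Context {K : fieldType} {n : nat}.
Hypothesis char0 : [pchar K] =i pred0.
Implicit Types (p : {mpoly K[n]}) (v w : 'I_n -> K).

Definition on_line v w : {mpoly K[n]} -> {poly K} :=
  mmap polyC (fun i => (v i)%:P + w i *: 'X).

HB.instance Definition _ v w := GRing.RMorphism.copy (on_line v w)
  (mmap polyC (fun i => (v i)%:P + w i *: 'X)).

Lemma on_lineZ v w c p : on_line v w (c *: p) = c *: on_line v w p.
Proof. by rewrite -mul_polyC [LHS]mmapZ. Qed.

Lemma horner_on_line v w p t :
  (on_line v w p).[t] = p.@[fun i => v i + t * w i].
Proof.
rewrite /on_line /mmap mevalE horner_sum; apply: eq_bigr => m _.
rewrite hornerM hornerC /mmap1 horner_prod; congr (_ * _).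
by apply: eq_bigr => i _; rewrite !hornerE mulrC.
Qed.

Lemma deriv_on_line v w p :
  (on_line v w p)^`() = \sum_i w i *: on_line v w p^`M(i).
Proof.
pose chain r := (on_line v w r)^`() = \sum_i w i *: on_line v w r^`M(i).
have chainD r s : chain r -> chain s -> chain (r + s).
  rewrite /chain => hr hs.
  rewrite rmorphD derivD hr hs -big_split /=.
  by apply: eq_bigr => i _; rewrite mderivD rmorphD scalerDr.
have chainC c : chain c%:MP.
  rewrite /chain [on_line _ _ _]mmapC derivC big1 // => i _.
  by rewrite mderivC rmorph0 scaler0.
have chainM r s : chain r -> chain s -> chain (r * s).
  rewrite /chain => hr hs.
  rewrite rmorphM derivM hr hs.
  rewrite mulr_suml mulr_sumr -big_split /=; apply: eq_bigr => i _.
  by rewrite mderivM rmorphD !rmorphM scalerDr scalerAl scalerAr.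
have chainX i : chain 'X_i.
  rewrite /chain [on_line _ _ _]mmapX mmap1U derivD derivC add0r derivZ derivX.
  rewrite (bigD1 i) //= big1 => [|j ji]; rewrite mderivX mnm1E.
    rewrite eqxx scale1r -[X in (X - _)%MM]addm0 addmC addmK mpolyX0.
    by rewrite rmorph1 addr0.
  by rewrite eq_sym (negbTE ji) scale0r rmorph0 scaler0.
rewrite -/(chain p); elim/mpolyind: p => [|c m p _ _ IHp].
  exact: chainC 0.
apply: chainD => //; rewrite -mul_mpolyC; apply: (chainM _ _) => //.
rewrite mpolyXE_id; apply: (big_ind chain) => [||i _]; first exact: chainC 1.
  exact: chainM.
elim: (m i) => [|k IHk]; first by rewrite expr0; exact: chainC 1.
by rewrite exprS; apply: (chainM _ _).
Qed.

Lemma deriv_eq0_horner (g : {poly K}) s t : g^`() = 0 -> g.[s] = g.[t].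
Proof.
move=> g0; have {g0} -> : g = (g`_0)%:P; last by rewrite !hornerC.
apply/polyP => -[|i]; rewrite coefC //=.
move/polyP/(_ i): g0; rewrite coef_deriv coef0 -mulr_natr => /eqP.
by rewrite mulf_eq0 (pcharf0P _).1 // orbF => /eqP.
Qed.

Lemma horner_eq0_poly (g : {poly K}) : (forall t, g.[t] = 0) -> g = 0.
Proof.
move=> g0; apply/eqP; apply: contraT => gN0.
pose rs := [seq i%:R : K | i <- iota 0 (size g)].
have /(max_poly_roots gN0) : all (root g) rs.
  by apply/allP => t _; rewrite /root g0.
rewrite size_map size_iota ltnn => -> //.
rewrite map_inj_uniq ?iota_uniq // => i j.
wlog leij : i j / (i <= j)%N.
  by move=> W; case/orP: (leq_total i j) => /W // Wij /esym/Wij.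
move=> /esym/eqP; rewrite -subr_eq0 -natrB // (pcharf0P _).1 // subn_eq0 => ji.
by apply/eqP; rewrite eqn_leq leij.
Qed.

(** The derivative of p along the line t |-> v + t w vanishes, so p takes the
    same value at t = 0 and at t = 1. *)
Lemma meval_translate p v w :
  \sum_i w i *: p^`M(i) = 0 -> p.@[fun i => v i + w i] = p.@[v].
Proof.
move=> dp0; have /(@deriv_eq0_horner _ 1 0) : (on_line v w p)^`() = 0.
  rewrite deriv_on_line -[RHS](rmorph0 (on_line v w)) -dp0 rmorph_sum /=.
  by apply: eq_bigr => i _; rewrite on_lineZ.
rewrite !horner_on_line => e; rewrite -[RHS](_ : p.@[fun i => v i + 0 * w i] = _).
  by rewrite -e; apply: meval_eq => i; rewrite mul1r.
by apply: meval_eq => i; rewrite mul0r addr0.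
Qed.

(** The partial derivatives of a polynomial that vanishes at all points vanish at
    all points too; in characteristic 0 they determine the coefficients of
    positive degree, which allows an induction on the degree of the monomial. *)
Lemma meval_eq0 p : (forall v, p.@[v] = 0) -> p = 0.
Proof.
move=> p0; apply/mpolyP => m; rewrite mcoeff0.
have [d] := ubnP (mdeg m); elim: d m p p0 => // d IHd m p p0 /ltnSE lemd.
have dp0 i v : p^`M(i).@[v] = 0.
  pose w j : K := (j == i)%:R.
  have : (on_line v w p)^`() = 0.
    by rewrite (@horner_eq0_poly (on_line v w p)) ?linear0 // => t;
      rewrite horner_on_line.
  rewrite deriv_on_line (bigD1 i) //= big1 ?addr0 => [|j /negbTE ji].
    rewrite /w eqxx scale1r => /(congr1 (horner^~ 0)); rewrite horner_on_line.
    by rewrite horner0 => <-; apply: meval_eq => j; rewrite mul0r addr0.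
  by rewrite /w ji scale0r.
have [->|mN0] := eqVneq m 0%MM.
  rewrite -[RHS](p0 (fun=> 0)) mevalE.
  have supp_bd k : k != 0%MM -> \prod_i (0 : K) ^+ k i = 0.
    move=> kN0; have [i ki] : exists i, k i != 0%N.
      apply/existsP; apply: contraNT kN0; rewrite negb_exists => /forallP k0.
      by apply/eqP/mnmP => i; rewrite mnm0E; apply/eqP; rewrite -[_ == _]negbK.
    by rewrite (bigD1 i) //= expr0n (negbTE ki) mul0r.
  have [in0|out0] := boolP (0%MM \in msupp p); last first.
    rewrite memN_msupp_eq0 // big_seq big1 // => k kp.
    by rewrite supp_bd ?mulr0 //; apply: contraNneq out0 => <-.
  rewrite (bigD1_seq 0%MM) ?msupp_uniq //= [X in _ + X]big1 ?addr0 => [|k kN0].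
    by rewrite big1 ?mulr1 // => i _; rewrite mnm0E expr0.
  by rewrite supp_bd ?mulr0.
have [i mi] : exists i, m i != 0%N.
  apply/existsP; apply: contraNT mN0; rewrite negb_exists => /forallP k0.
  by apply/eqP/mnmP => i; rewrite mnm0E; apply/eqP; rewrite -[_ == _]negbK.
have em : m = (m - U_(i) + U_(i))%MM by rewrite submK // lep1mP.
have := IHd (m - U_(i))%MM _ (dp0 i); rewrite mcoeff_deriv -em.
have -> : (mdeg (m - U_(i))%MM < d)%N.
  by move: lemd; rewrite {1}em mdegD mdeg1 addn1.
move/(_ isT)/eqP; rewrite -mulr_natr mulf_eq0 (pcharf0P _).1 // orbF.
by move/eqP.
Qed.

End Lines.

(** * Orthogonal subspaces of a skew form *)

Section Orthogonal.
Context {K : fieldType} {V : vectType K}.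
Local Notation e := (vbasis {:V}).
Local Notation n := (\dim {:V}).
Implicit Types U W S : {vspace V}.

Definition basis_mx U : 'M[K]_(\dim U, n) := \matrix_i rVof e (vbasis U)`_i.

Lemma mul_basis_mx U u :
  u *m basis_mx U = rVof e (\sum_i u 0 i *: (vbasis U)`_i).
Proof.
rewrite mulmx_sum_row linear_sum; apply: eq_bigr => i _.
by rewrite rowK linearZ.
Qed.

Lemma sub_basis_mx U x : (rVof e x <= basis_mx U)%MS = (x \in U).
Proof.
apply/submxP/idP => [[u]|xU].
  rewrite mul_basis_mx => /(can_inj (rVofK (vbasisP _))) ->.
  rewrite memv_suml // => i _.
  by rewrite memvZ // vbasis_mem ?mem_nth ?size_tuple.
exists (\row_i coord (vbasis U) i x); rewrite mul_basis_mx {1}(coord_vbasis xU).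
by congr (rVof e _); apply: eq_bigr => i _; rewrite mxE.
Qed.

Lemma rank_basis_mx U : \rank (basis_mx U) = \dim U.
Proof.
apply/eqP/row_freeP; exists (pinvmx (basis_mx U)); apply: mulmxVp.
rewrite -kermx_eq0; apply/rowV0P => u /sub_kermxP.
rewrite mul_basis_mx => /eqP; rewrite rVof_eq0 ?vbasisP // => /eqP u0.
apply/rowP => i; rewrite mxE.
by have /freeP/(_ (fun i => u 0 i) u0 i) := basis_free (vbasisP U).
Qed.

Lemma basis_mx_kermx (G : 'M[K]_n) S :
  (forall x, (x \in S) = (rVof e x *m G == 0)) ->
  (basis_mx S :=: kermx G)%MS.
Proof.
move=> kerG; apply/eqmxP/andP; split; apply/rV_subP => u;
by rewrite -[u](vecofK (vbasisP _)) (sameP sub_kermxP eqP) sub_basis_mx kerG.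
Qed.

(** Writing U^perp for the orthogonal of U under the skew form G with radical S,
    dim U^perp = dim V - dim U + dim (U :&: S). When W, inside U^perp, is large
    enough, this forces dim (U :&: S) >= dim S. *)
Lemma radical_sub_of_orthogonal (G : 'M[K]_n) U W S :
  G^T = - G ->
  (forall x, (x \in S) = (rVof e x *m G == 0)) ->
  (forall w u, w \in W -> u \in U -> rVof e w *m G *m (rVof e u)^T = 0) ->
  (n + \dim S <= \dim U + \dim W)%N -> (S <= U)%VS.
Proof.
move=> Gskew kerG UW le_dim.
have MW : basis_mx W *m (G *m (basis_mx U)^T) = 0.
  have vb (T : {vspace V}) (i : 'I_(\dim T)) : (vbasis T)`_i \in T.
    by rewrite vbasis_mem ?mem_nth ?size_tuple.
  apply/matrixP => i j; rewrite mulmxA mxE.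
  move/matrixP/(_ 0 0): (UW _ _ (vb _ i) (vb _ j)); rewrite !mxE => h.
  rewrite -[RHS]h; apply: eq_bigr => k _; rewrite !mxE; congr (_ * _).
  by apply: eq_bigr => l _; rewrite !mxE.
have eqS := basis_mx_kermx _ _ kerG.
(* As G^T = - G, the matrix G * U^T has the rank of U * G, which is dim U minus
   the dimension of the intersection of U with the radical S. *)
have := mulmx0_rank_max MW.
rewrite -[\rank (_ *m _)]mxrank_tr trmx_mul trmxK Gskew mulmxN mxrank_opp.
rewrite !rank_basis_mx => le1.
have := mxrank_mul_ker (basis_mx U) G; rewrite rank_basis_mx => le2.
have geS : (\dim S <= \rank (basis_mx U :&: kermx G))%N.
  rewrite -(leq_add2l n); apply: leq_trans le_dim _.
  by rewrite -[X in (X + _)%N]le2 addnAC leq_add2r addnC.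
have : (kermx G <= basis_mx U :&: kermx G)%MS.
  rewrite -(geq_leqif (mxrank_leqif_sup (capmxSr _ _))).
  by rewrite -eqS (rank_basis_mx S).
rewrite sub_capmx => /andP [kerU _]; apply/subvP => x.
by rewrite -(sub_basis_mx S) eqS -(sub_basis_mx U) => /submx_trans; apply.
Qed.

End Orthogonal.

(** * Symmetric algebras as polynomial functions on the dual *)

Section Points.
Context {K : fieldType} {V : vectType K}.
Local Notation e := (vbasis {:V}).
Local Notation n := (\dim {:V}).
Implicit Types (xi : 'Hom(V, K^o)).

Definition point xi : 'I_n -> K := fun i => xi e`_i.

Lemma meval_sym_inj xi v : (sym_inj v).@[point xi] = xi v.
Proof.
rewrite /sym_inj [in RHS](coord_vbasis (memvf v)) raddf_sum linear_sum /=.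
by apply: eq_bigr => i _; rewrite mevalZ mevalXU linearZ.
Qed.

Lemma exists_point (v : 'I_n -> K) : exists xi, point xi =1 v.
Proof.
pose f (x : V) : K^o := \sum_i coord e i x * v i.
have lin : linear f.
  move=> a x y; rewrite /f scaler_sumr -big_split /=; apply: eq_bigr => i _.
  by rewrite linearP /= mulrDl -mulrA.
pose h := GRing.isLinear.Build _ _ _ _ _ lin.
pose g : {linear V -> K^o} := HB.pack f h.
exists (linfun g) => i; rewrite /point lfunE /= /f (bigD1 i) //= big1 => [|j ji].
  by rewrite coord_free ?(basis_free (vbasisP _)) // eqxx mul1r addr0.
rewrite coord_free ?(basis_free (vbasisP _)) //.
by rewrite -[_ == _]/(i == j) eq_sym (negbTE ji) mul0r.
Qed.

End Points.

Lemma meval_sym_map {K : fieldType} {V W : vectType K} (f : V -> W) p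
    (xi : 'Hom(W, K^o)) :
  (sym_map f p).@[point xi] = p.@[fun i => xi (f (vbasis {:V})`_i)].
Proof.
rewrite comp_mpoly_meval; apply: meval_eq => i.
by rewrite tnth_mktuple meval_sym_inj.
Qed.

(** * Stabilisers of the coadjoint representation *)

Section Coadjoint.
Context {K : fieldType} {q : lieType K}.
Local Notation e := (vbasis {:q}).
Local Notation n := (\dim {:q}).
Implicit Types (xi : 'Hom(q, K^o)) (U W : {vspace q}) (F : Sym q).

HB.instance Definition _ (x : q) :=
  GRing.isLinear.Build K q q _ (lieb x) (lieb_linear_r x).

Lemma lieC (x y : q) : [lie x, y] = - [lie y, x].
Proof.
have lieDl z a b : [lie a + b, z] = [lie a, z] + [lie b, z] :> q.
  by have := lieb_linear_l z 1 a b; rewrite !scale1r.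
apply/eqP; rewrite -addr_eq0; have := liebxx (x + y).
by rewrite lieDl !linearD /= !liebxx add0r addr0 => ->.
Qed.

Lemma stabP xi x : reflect (forall y, xi [lie x, y] = 0) (x \in stab xi).
Proof.
rewrite mem_stab; apply: (iffP eqP) => [/lfunP stx y|stx].
  by apply: oppr_inj; rewrite -coadjE stx lfunE oppr0.
by apply/lfunP => y; rewrite coadjE stx lfunE oppr0.
Qed.

(** The matrix of the form xi [lie x, y] with xi left generic: its minors are
    the polynomials that detect regular points. *)
Definition bracket_mx : 'M[Sym q]_n := \matrix_(i, j) sym_inj [lie e`_i, e`_j].
Definition form_mx xi : 'M[K]_n := map_mx (meval (point xi)) bracket_mx.

Lemma form_mxE xi x y :
  rVof e x *m form_mx xi *m (rVof e y)^T = (xi [lie x, y])%:M.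
Proof.
rewrite [form_mx xi](_ : _ = \matrix_(i, j) xi [lie e`_i, e`_j]); last first.
  by apply/matrixP => i j; rewrite !mxE meval_sym_inj.
apply/rowP => k; rewrite !ord1 !mxE mulr1n.
rewrite [in RHS](coord_vbasis (memvf y)) !linear_sum /=.
apply: eq_bigr => j _; rewrite !mxE !linearZ /= mulrC; congr (_ * _).
rewrite lieC [in RHS](coord_vbasis (memvf x)) linear_sum -sumrN linear_sum /=.
by apply: eq_bigr => i _; rewrite !mxE linearZ -scalerN -lieC linearZ.
Qed.

Lemma form_mx_skew xi : (form_mx xi)^T = - form_mx xi.
Proof. by apply/matrixP => i j; rewrite !mxE !meval_sym_inj lieC linearN. Qed.

Lemma stab_kermx xi x : (x \in stab xi) = (rVof e x *m form_mx xi == 0).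
Proof.
apply/stabP/eqP => [stx|x0 y]; last first.
  move: (form_mxE xi x y); rewrite x0 mul0mx => /matrixP/(_ 0 0).
  by rewrite !mxE mulr1n.
apply/rowP => j; have := form_mxE xi x e`_j; rewrite stx rVofE ?vbasisP //.
by rewrite trmx_delta -colE => /matrixP/(_ 0 0); rewrite !mxE mul0rn.
Qed.

Lemma dim_stab xi : (\dim (stab xi) + \rank (form_mx xi) = n)%N.
Proof.
rewrite -rank_basis_mx (basis_mx_kermx _ _ (stab_kermx xi)).
by rewrite mxrank_ker subnK // rank_leq_row.
Qed.

Lemma stab_sub_of_orthogonal xi U W :
  (forall w u, w \in W -> u \in U -> xi [lie w, u] = 0) ->
  (n + \dim (stab xi) <= \dim U + \dim W)%N -> (stab xi <= U)%VS.
Proof.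
move=> UW.
apply: radical_sub_of_orthogonal (form_mx_skew xi) (stab_kermx xi) _.
by move=> w u wW uU; rewrite form_mxE UW // raddf0.
Qed.

(** The rank of [form_mx] is lower semicontinuous: D is a generalised minor of
    [bracket_mx], of the maximal size r, that is nonzero at a regular point. *)
Lemma exists_regular_poly :
  exists2 D : Sym q, D != 0 &
    forall xi, D.@[point xi] != 0 -> \dim (stab xi) = ind q.
Proof.
have [[xi0 dim0] ind_le] := ind_min q.
set G := form_mx xi0; set r := \rank G.
(* L * G * Q = 1 for the one-sided inverses L and Q of the factors of G. *)
pose L := map_mx (@mpolyC n K) (pinvmx (col_base G)).
pose Q := map_mx (@mpolyC n K) (pinvmx (row_base G)).
pose D := \det (L *m bracket_mx *m Q).
have evalD xi : D.@[point xi] =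
    \det (pinvmx (col_base G) *m form_mx xi *m pinvmx (row_base G)).
  rewrite /D -det_map_mx !map_mxM; congr (\det (_ *m _ *m _));
  by apply/matrixP => i j; rewrite !mxE [LHS]mevalC.
exists D => [|xi].
  apply: contraTneq isT => D0; have := evalD xi0; rewrite D0 meval0 -/G.
  rewrite -[in X in _ *m X *m _](mulmx_base G) mulmxA mulVpmx ?col_base_full //.
  rewrite mul1mx mulmxVp ?row_base_free // det1 => /eqP.
  by rewrite eq_sym oner_eq0.
rewrite evalD -unitfE -unitmxE => /mxrank_unit rk_r.
apply/eqP; rewrite eqn_leq ind_le andbT -dim0.
rewrite -(leq_add2r (\rank (form_mx xi))) dim_stab.
rewrite -[X in (X <= _)%N](dim_stab xi0) leq_add2l -/G -/r -[r in (r <= _)%N]rk_r.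
by rewrite (leq_trans (mxrankM_maxl _ _)) // mxrankM_maxr.
Qed.

Definition differential F xi : q := \sum_i (F^`M(i)).@[point xi] *: e`_i.

(** Evaluated at xi, the invariance equation [sym_ad y F = 0] reads
    xi [lie y, d_xi F] = 0. *)
Lemma differential_stab F xi :
  sym_invariants q F -> differential F xi \in stab xi.
Proof.
move=> Finv; apply/stabP => y; rewrite lieC linearN; apply/eqP.
rewrite oppr_eq0 !linear_sum /=.
have := congr1 (meval (point xi)) (Finv y); rewrite meval0 => Fy.
apply/eqP; apply: etrans Fy; rewrite raddf_sum /=.
by apply: eq_bigr => i _; rewrite mevalM meval_sym_inj mulrC !linearZ.
Qed.

End Coadjoint.

(** * From stabilisers to symmetric subalgebras *)

Section Char0.
Context {K : fieldType} {q : lieType K}.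
Hypothesis char0 : [pchar K] =i pred0.
Implicit Types (U : {vspace q}) (F : Sym q).

(** At regular xi the value of this derivative is zeta (d_xi F), and d_xi F lies
    in stab xi, hence in U. *)
Lemma conormal_derivative_eq0 U F (zeta : 'Hom(q, K^o)) :
  (forall xi, \dim (stab xi) = ind q -> stab xi <= U)%VS ->
  sym_invariants q F -> {in U, forall x, zeta x = 0} ->
  \sum_i point zeta i *: F^`M(i) = 0.
Proof.
move=> regU Finv zetaU; have [D DN0 regD] := @exists_regular_poly K q.
suff /eqP : D * \sum_i point zeta i *: F^`M(i) = 0.
  by rewrite mulf_eq0 (negbTE DN0) => /eqP.
apply: (meval_eq0 char0) => v; have [xi xiv] := exists_point v.
rewrite -!(meval_eq _ xiv) mevalM; apply/eqP; rewrite mulf_eq0.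
have [//|/regD/regU stabU] := boolP (D.@[point xi] == 0).
have := zetaU _ (subvP stabU _ (differential_stab _ xi Finv)).
rewrite /= /differential linear_sum raddf_sum /= => e0.
apply/eqP; apply: etrans e0; apply: eq_bigr => i _.
by rewrite mevalZ linearZ mulrC.
Qed.

(** A linear form xi and its composition with the projection onto U differ by a
    form killing U, so F takes the same value at both; hence F is the image of
    its own projection to S(U). *)
Lemma sym_sub_of_conormal U F :
  (forall zeta : 'Hom(q, K^o), {in U, forall x, zeta x = 0} ->
     \sum_i point zeta i *: F^`M(i) = 0) -> sym_sub U F.
Proof.
move=> dF0; pose pr (x : q) : subvs_of U := vsproj U (projv U x).
exists (sym_map pr F) => //; apply/eqP; rewrite eq_sym -subr_eq0; apply/eqP.
apply: (meval_eq0 char0) => v; have [xi xiv] := exists_point v.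
rewrite -!(meval_eq _ xiv) mevalB meval_sym_map; apply/eqP; rewrite subr_eq0.
pose xiU : 'Hom(subvs_of U, K^o) := (xi \o linfun vsval)%VF.
pose zeta : 'Hom(q, K^o) := xi - (xi \o projv U)%VF.
have zetaU : {in U, forall x, zeta x = 0}.
  by move=> x xU; rewrite /zeta add_lfunE opp_lfunE comp_lfunE projv_id ?subrr.
rewrite -(meval_eq (v1 := point xiU)) => [|i]; last first.
  by rewrite /point /xiU comp_lfunE lfunE.
rewrite meval_sym_map; apply/eqP.
rewrite -[RHS](meval_translate char0 _ _ _ (dF0 _ zetaU)).
apply: meval_eq => i.
rewrite /point /zeta add_lfunE opp_lfunE !comp_lfunE.
by rewrite lfunE /= vsprojK ?memv_proj // addrC subrK.
Qed.

Lemma invariants_sub_of_stab U :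
  (forall xi, \dim (stab xi) = ind q -> stab xi <= U)%VS ->
  sym_invariants q `<=` sym_sub U.
Proof.
move=> regU F Finv; apply: sym_sub_of_conormal => zeta.
exact: conormal_derivative_eq0.
Qed.

End Char0.

(** * Subalgebras with the same b and commutative polarisations *)

Lemma eq_bnum (K L : fieldType) (q : lieType K) (q' : lieType L) :
  bnum q' = bnum q -> (\dim {:q'} + ind q' = \dim {:q} + ind q)%N.
Proof.
move=> /(congr1 ( *%R^~ 2)); rewrite !divfK ?pnatr_eq0 // => /eqP.
by rewrite eqr_nat => /eqP.
Qed.

(** The stabiliser in q' of the restriction of xi is orthogonal to q', and its
    dimension is at least ind q' whether or not this restriction is regular. *)
Lemma regular_stab_sub_subalg {K : fieldType} {q : lieType K}
    (q' : lieSubalg q) (xi : 'Hom(q, K^o)) :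
  bnum (subvs_of q') = bnum q -> \dim (stab xi) = ind q ->
  (stab xi <= q')%VS.
Proof.
move=> /eq_bnum eb reg.
pose xi' : 'Hom(subvs_of q', K^o) := (xi \o linfun vsval)%VF.
have dimq' : \dim {:subvs_of q'} = \dim q' by rewrite dimvf.
apply: (stab_sub_of_orthogonal _ _ (linfun vsval @: stab xi')%VS).
  move=> _ u /memv_imgP[w /stabP w0 ->] uq'; rewrite lfunE /=.
  have := w0 (vsproj q' u); rewrite comp_lfunE lfunE /=.
  by rewrite -[vsval (lieb _ _)]/(vsval (sub_lieb _ _)) sub_liebE vsprojK.
rewrite reg -eb dimq' leq_add2l limg_dim_eq.
  by case: (ind_min (subvs_of q')).
apply/eqP; rewrite -subv0; apply/subvP => w.
rewrite memv_cap memv_ker lfunE memv0 => /andP[_ /eqP w0].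
by apply/eqP/val_inj.
Qed.

(** An abelian a is orthogonal to itself for every xi. *)
Lemma regular_stab_sub_polarisation {K : fieldType} {q : lieType K}
    (a : {vspace q}) (xi : 'Hom(q, K^o)) :
  comm_polarisation a -> \dim (stab xi) = ind q -> (stab xi <= a)%VS.
Proof.
case=> _ aab dima reg; apply: (stab_sub_of_orthogonal _ _ a).
  by move=> w u wa ua; rewrite aab // linear0.
rewrite reg; move/(congr1 ( *%R^~ 2)): dima; rewrite divfK ?pnatr_eq0 //.
by rewrite -natrM => /eqP; rewrite eqr_nat muln2 -addnn => /eqP ->.
Qed.

Theorem proposition5p5 (R : realType) (q : lieType R[i]) :
  (forall q' : lieSubalg q, bnum (subvs_of q') = bnum q ->
     sym_invariants q `<=` sym_sub q') /\
  (forall a : {vspace q}, comm_polarisation a ->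
     sym_invariants q `<=` sym_sub a) /\
  (forall (k : nat) (a : 'I_k -> {vspace q}), (0 < k)%N -> injective a ->
     (forall i, comm_polarisation (a i)) ->
     sym_invariants q `<=` sym_sub (\bigcap_(i < k) a i)%VS).
Proof.
have char0 : [pchar R[i]] =i pred0 by exact: pchar_num.
split=> [q' eb|]; last split=> [a pol|k a _ _ pol];
  apply: (invariants_sub_of_stab char0) => xi reg.
- exact: regular_stab_sub_subalg.
- exact: regular_stab_sub_polarisation.
- by apply/subv_bigcapP => i _; exact: regular_stab_sub_polarisation.
Qed.
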